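(* Let $X$ be a complex Banach space and let $A:D(A)\subset X\to X$ be the generator of an immediately differentiable quasi-compact $C_0$-semigroup $(e^{tA})_{t\ge0}$ on $X$. Let $B\in\mathcal L(X)$ be a bounded linear operator such that $Be^{tA}$ is compact for all $t>0$. Then the $C_0$-semigroup $(e^{t(A+B)})_{t\ge0}$ generated by $A+B$ is quasi-compact.
   Context: A $C_0$-semigroup $(T(t))_{t\ge0}$ is immediately differentiable if $t\mapsto T(t)x$ is differentiable on $(0,\infty)$ for every $x\in X$. The operator $A+B$ has domain $D(A+B)=D(A)$. A $C_0$-semigroup $(T(t))_{t\ge0}$ on $X$ is quasi-compact if $\lim_{t\to\infty}\inf\{\|T(t)-K\|_{\mathcal L(X)} : K\in\mathcal L(X),\ K \text{ compact}\}=0$. *)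

(* Defs.v *)
From Stdlib Require Import Reals List.
From Coquelicot Require Import Coquelicot.

Set Implicit Arguments.
Unset Strict Implicit.

Open Scope R_scope.

(** A complex Banach space is a [CompleteNormedModule C_AbsRing].  A bounded
    linear operator on [X] is a function satisfying Coquelicot's [is_linear],
    which includes the norm bound. *)
Notation complex_banach := (CompleteNormedModule C_AbsRing).

(** ** Compact operators and the operator norm *)

Definition closure {U : UniformSpace} (S : U -> Prop) (x : U) : Prop :=
  forall P : U -> Prop, locally x P -> exists y, P y /\ S y.

(** Covers are given as collections of sets, subcovers as finite lists. *)
Definition compact_set {U : UniformSpace} (S : U -> Prop) : Prop :=
  forall cover : (U -> Prop) -> Prop,
    (forall O, cover O -> open O) ->
    (forall x, S x -> exists O, cover O /\ O x) ->
    exists l : list (U -> Prop),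
      (forall O, In O l -> cover O) /\
      (forall x, S x -> exists O, In O l /\ O x).

Definition compact_operator {X : complex_banach} (K : X -> X) : Prop :=
  compact_set (closure (fun y : X => exists x : X, norm x <= 1 /\ y = K x)).

(** The supremum is finite when [L] is bounded; [real] would send an infinite
    supremum to 0, so [op_norm] is meaningful for bounded operators only. *)
Definition op_norm {X : complex_banach} (L : X -> X) : R :=
  real (Lub_Rbar (fun r => exists x : X, norm x <= 1 /\ r = norm (L x))).

(** ** Unbounded operators *)

(** The values of [op_fun] outside [op_dom] are irrelevant. *)
Record operator (X : complex_banach) : Type := Operator {
  op_dom : X -> Prop;
  op_fun : X -> X
}.

Definition op_add {X : complex_banach} (A : operator X) (B : X -> X)
  : operator X :=
  Operator (op_dom A) (fun x => plus (op_fun A x) (B x)).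

(** ** Semigroups *)

(** A family [T : R -> X -> X] stands for [(T t)] with [t >= 0]; its values at
    negative times are irrelevant. *)
Definition C0_semigroup {X : complex_banach} (T : R -> X -> X) : Prop :=
  (forall t, 0 <= t -> is_linear (T t)) /\
  (forall x, T 0 x = x) /\
  (forall s t x, 0 <= s -> 0 <= t -> T (s + t) x = T s (T t x)) /\
  (forall x, filterlim (fun t => T t x) (at_right 0) (locally x)).

(** [X] carries complex scalars only, so the real factor [/ h] of a difference
    quotient in the real variable acts through [RtoC]. *)
Definition diff_quotient {X : complex_banach} (f : R -> X) (t h : R) : X :=
  scal (RtoC (/ h) : C_AbsRing) (minus (f (t + h)) (f t)).

Definition is_generator {X : complex_banach} (A : operator X)
    (T : R -> X -> X) : Prop :=
  (forall x, op_dom A x <->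
     exists y, filterlim (diff_quotient (fun t => T t x) 0)
                 (at_right 0) (locally y)) /\
  (forall x, op_dom A x ->
     filterlim (diff_quotient (fun t => T t x) 0)
       (at_right 0) (locally (op_fun A x))).

Definition immediately_differentiable {X : complex_banach}
    (T : R -> X -> X) : Prop :=
  forall (x : X) (t : R), 0 < t ->
    exists y, filterlim (diff_quotient (fun s => T s x) t)
                (locally' 0) (locally y).

(** The infimum is over a nonempty set ([K = 0] is allowed) bounded below by 0,
    hence finite. *)
Definition dist_to_compacts {X : complex_banach} (L : X -> X) : R :=
  real (Glb_Rbar (fun r => exists K : X -> X,
    is_linear K /\ compact_operator K /\
    r = op_norm (fun x => minus (L x) (K x)))).

Definition quasi_compact {X : complex_banach} (T : R -> X -> X) : Prop :=
  is_lim (fun t => dist_to_compacts (T t)) p_infty 0.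

(* Main.v *)
Require Import Defs.
From Stdlib Require Import Reals List Lra Classical ClassicalEpsilon ssreflect.
From Coquelicot Require Import Coquelicot.

Open Scope R_scope.

(** The point is that [S t - T t] is a compact operator for every [t > 0]; then
    [S t] and [T t] are at the same distance from the compact operators, and
    quasi-compactness passes from [T] to [S].

    By the variation of constants formula,
      [S t - T t = int_0^t S (t - r) B T r dr].
    Immediate differentiability is used twice.  First, it makes [r |-> T r]
    continuous in operator norm on [(0, oo)]
    ([norm_continuous_of_differentiable], by uniform boundedness of the
    difference quotients).  As each [B T r] is compact and [S] is strongly
    continuous, the integrand is then a norm-continuous family of compact
    operators on [(0, t]] ([integrand_norm_continuous]), and Riemann sums, which
    are compact, approximate its integral in norm.  Second, [T r x] lies in the
    domain of [A] for every [x] and every [r > 0], so the formula can be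
    differentiated on the whole space.

    No integral is actually formed.  The map [r |-> S (t - r) (T r x)] goes from
    [S t x] to [T t x] and has right derivative [- S (t - r) B (T r x)]; a mean
    value inequality ([mean_value_inequality]) bounds the distance between its
    increments and those with a constant derivative
    ([variation_of_constants_estimate]), and real induction assembles the Riemann
    sum ([increment_near_compact]).  Norm approximation of [S t - T t] by compact
    operators is all that the distance argument requires
    ([dist_to_compacts_le_of_difference]).

    The functional analysis behind this is a local form of the Banach-Steinhaus
    theorem and the fact that, in a complete space, a set has compact closure
    exactly when it is totally bounded, so that compact operators are stable
    under sums and under composition with bounded ones. *)

(** * Real induction *)

(** The form of completeness of the reals that lets an estimate be continued from
    [a] to [b] without choosing a partition beforehand. *)
Lemma real_induction (P : R -> Prop) (a b : R) :
  a <= b -> P a ->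
  (forall s, a <= s < b -> P s ->
     exists d, 0 < d /\ forall v, s < v < s + d -> v <= b -> P v) ->
  (forall s, a < s <= b -> (forall r, a <= r < s -> P r) -> P s) ->
  P b.
Proof.
intros hab ha hright hleft.
set (E := fun s => a <= s <= b /\ forall r, a <= r <= s -> P r).
assert (Ea : E a).
{ split; [lra|]. intros r hr. replace r with a by lra. exact ha. }
destruct (completeness E) as [m [ub lub]].
{ exists b. intros s [hs _]. lra. }
{ now exists a. }
assert (ham : a <= m) by now apply ub.
assert (hmb : m <= b) by (apply lub; intros s [hs _]; lra).
assert (below : forall r, a <= r < m -> P r).
{ intros r hr. apply NNPP; intro hn.
  assert (m <= r); [|lra].
  apply lub. intros s [hs Ps].
  destruct (Rle_or_lt s r) as [|hlt]; [assumption|].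
  exfalso. apply hn, Ps. lra. }
assert (Pm : P m).
{ destruct (Req_dec m a) as [->|hne]; [exact ha|].
  apply hleft; [lra|exact below]. }
destruct (Req_dec m b) as [<-|hne]; [exact Pm|exfalso].
destruct (hright m) as [d [hd Pd]]; [lra|exact Pm|].
assert (hv : E (Rmin b (m + d / 2))).
{ pose proof (Rmin_l b (m + d / 2)). pose proof (Rmin_r b (m + d / 2)).
  split; [split; [apply Rmin_glb; lra|assumption]|].
  intros r hr.
  destruct (Rlt_or_le r m) as [|hmr]; [apply below; lra|].
  destruct (Req_dec r m) as [->|]; [exact Pm|apply Pd; lra]. }
apply ub in hv. revert hv. apply Rmin_case; lra.
Qed.

(** * Norms of vectors and bounded linear operators *)

Lemma minus_plus_plus {G : AbelianGroup} (a b c d : G) :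
  minus (plus a b) (plus c d) = plus (minus a c) (minus b d).
Proof.
unfold minus. rewrite opp_plus -!plus_assoc. f_equal.
rewrite (plus_comm b) -plus_assoc. f_equal. apply plus_comm.
Qed.

Lemma minus_minus_minus {G : AbelianGroup} (a b c d : G) :
  minus (minus a b) (minus c d) = minus (minus a c) (minus b d).
Proof.
change (minus (plus a (opp b)) (plus c (opp d)) = minus (minus a c) (minus b d)).
rewrite minus_plus_plus. unfold minus at 1 3. f_equal.
unfold minus. now rewrite -opp_plus.
Qed.

Lemma minus_plus_cancel {G : AbelianGroup} (a b : G) :
  minus (plus a b) b = a.
Proof.
unfold minus. now rewrite -plus_assoc plus_opp_r plus_zero_r.
Qed.

Section Norms.

Context {X : NormedModule C_AbsRing}.
Implicit Types (x y z : X) (L M : X -> X).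

Lemma norm_minus_self x : norm (minus x x) = 0.
Proof. rewrite minus_eq_zero. exact norm_zero. Qed.

Lemma norm_minus_sym x y : norm (minus x y) = norm (minus y x).
Proof. rewrite -(norm_opp (minus x y)). now rewrite opp_minus. Qed.

Lemma norm_minus_le_via z x y :
  norm (minus x y) <= norm (minus x z) + norm (minus z y).
Proof. rewrite (minus_trans z). apply norm_triangle. Qed.

Lemma norm_minus_le x y : norm (minus x y) <= norm x + norm y.
Proof. unfold minus. rewrite -(norm_opp y). apply norm_triangle. Qed.

Lemma norm_le_minus x y : norm x <= norm (minus x y) + norm y.
Proof.
rewrite -{1}(minus_zero_r x) -{2}(minus_zero_r y).
apply norm_minus_le_via.
Qed.

Definition rscal (r : R) x : X := scal (RtoC r : C_AbsRing) x.

Lemma rscal_plus_l r s x : rscal (r + s) x = plus (rscal r x) (rscal s x).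
Proof.
unfold rscal. rewrite RtoC_plus.
exact (scal_distr_r (RtoC r : C_AbsRing) (RtoC s) x).
Qed.

Lemma rscal_mult r s x : rscal r (rscal s x) = rscal (r * s) x.
Proof.
unfold rscal. rewrite RtoC_mult.
exact (scal_assoc (RtoC r : C_AbsRing) (RtoC s) x).
Qed.

Lemma rscal_1 x : rscal 1 x = x.
Proof. exact (scal_one x). Qed.

Lemma rscal_0 x : rscal 0 x = zero.
Proof. exact (scal_zero_l x). Qed.

Lemma rscal_minus r x y : rscal r (minus x y) = minus (rscal r x) (rscal r y).
Proof. exact (scal_minus_distr_l (RtoC r : C_AbsRing) x y). Qed.

Lemma norm_rscal_le r x : norm (rscal r x) <= Rabs r * norm x.
Proof.
rewrite -Cmod_R. exact (norm_scal (RtoC r : C_AbsRing) x).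
Qed.

Lemma norm_rscal r x : norm (rscal r x) = Rabs r * norm x.
Proof.
apply Rle_antisym; [apply norm_rscal_le|].
destruct (Req_dec r 0) as [->|hr].
{ rewrite Rabs_R0 Rmult_0_l. apply norm_ge_0. }
assert (hr' : 0 < Rabs r) by now apply Rabs_pos_lt.
apply Rmult_le_reg_l with (/ Rabs r); [now apply Rinv_0_lt_compat|].
rewrite -Rmult_assoc Rinv_l ?Rmult_1_l; [|lra].
rewrite -Rabs_inv.
replace x with (rscal (/ r) (rscal r x)) at 1; [apply norm_rscal_le|].
now rewrite rscal_mult (Rinv_l r hr) rscal_1.
Qed.

Lemma linear_rscal L r x : is_linear L -> L (rscal r x) = rscal r (L x).
Proof. intros hL. exact (linear_scal L hL (RtoC r) x). Qed.

Lemma is_linear_rscal_comp r L : is_linear L -> is_linear (fun x => rscal r (L x)).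
Proof.
intros hL. apply is_linear_comp with (l2 := rscal r); [exact hL|].
exact (is_linear_scal_r (RtoC r : C_AbsRing) Cmult_comm).
Qed.

Lemma is_linear_plus_fun L M :
  is_linear L -> is_linear M -> is_linear (fun x => plus (L x) (M x)).
Proof.
intros hL hM.
exact (is_linear_comp _ _ (is_linear_prod _ _ hL hM) is_linear_plus).
Qed.

Lemma is_linear_minus_fun L M :
  is_linear L -> is_linear M -> is_linear (fun x => minus (L x) (M x)).
Proof.
intros hL hM. apply (is_linear_plus_fun L (fun x => opp (M x))); [exact hL|].
exact (is_linear_comp _ _ hM is_linear_opp).
Qed.

Lemma locally_normP x (P : X -> Prop) :
  locally x P <-> exists e, 0 < e /\ forall y, norm (minus y x) < e -> P y.
Proof.
split.
- intros h. destruct (locally_norm_le_locally x P h) as [e he].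
  exists e. split; [apply cond_pos|exact he].
- intros [e [he h]]. apply locally_le_locally_norm.
  now exists (mkposreal e he).
Qed.

Lemma open_norm_ball x e : open (fun y => norm (minus y x) < e).
Proof.
intros y hy. apply locally_normP. exists (e - norm (minus y x)).
split; [lra|]. intros z hz. pose proof (norm_minus_le_via y z x). lra.
Qed.

Lemma filterlim_at_right_norm (f : R -> X) a l :
  filterlim f (at_right a) (locally l) ->
  forall e, 0 < e -> exists d, 0 < d /\
    forall h, 0 < h < d -> norm (minus (f (a + h)) l) < e.
Proof.
intros hf e he.
destruct (hf (fun y => norm (minus y l) < e)) as [d hd].
{ apply locally_normP. now exists e. }
exists d. split; [apply cond_pos|]. intros h hh. apply hd; [|lra].
change (Rabs (a + h - a) < d). rewrite Rabs_pos_eq; lra.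
Qed.

End Norms.

(** * Completeness: nested balls and uniform boundedness *)

Section Completeness.

Context {X : CompleteNormedModule C_AbsRing}.
(* The same type, but its operations are then inferred through the normed module,
   so that they agree syntactically with those of the preceding section. *)
Local Notation V := (CompleteNormedModule.NormedModule C_AbsRing X).
Implicit Types (x y z : V).

Lemma decreasing_sets (E : nat -> V -> Prop) :
  (forall n x, E (S n) x -> E n x) ->
  forall n k x, E (n + k)%nat x -> E k x.
Proof.
intros decr. induction n as [|n IH]; intros k x hx; [exact hx|].
apply IH, decr, hx.
Qed.

(** [complete_cauchy] for the filter generated by the sequence [E]. *)
Lemma cantor_intersection (E : nat -> V -> Prop) :
  (forall n x, E (S n) x -> E n x) ->
  (forall n, exists x, E n x) ->
  (forall e, 0 < e -> exists n c, forall x, E n x -> norm (minus x c) < e) ->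
  exists z, forall e, 0 < e ->
    exists n, forall x, E n x -> norm (minus x z) < e.
Proof.
intros decr nonempty small.
set (F := fun P : V -> Prop => exists n, forall x, E n x -> P x).
assert (PF : ProperFilter F).
{ split.
  - intros P [n hn]. destruct (nonempty n) as [x hx]. exists x. auto.
  - split.
    + now exists 0%nat.
    + intros P Q [n hn] [k hk]. exists (n + k)%nat. intros x hx. split.
      * apply hn, (decreasing_sets E decr k). now rewrite Nat.add_comm.
      * apply hk, (decreasing_sets E decr n), hx.
    + intros P Q hPQ [n hn]. exists n. auto. }
assert (CF : cauchy F).
{ intros e. destruct (small e (cond_pos e)) as [n [c hc]].
  exists c, n. intros x hx. exact (@norm_compat1 _ V c x e (hc x hx)). }
exists (lim F). intros e he.
assert (hnf := @norm_factor_gt_0 _ V).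
assert (he' : 0 < e / @norm_factor _ V) by now apply Rdiv_lt_0_compat.
destruct (complete_cauchy F PF CF (mkposreal _ he')) as [n hn].
exists n. intros x hx.
apply hn, (@norm_compat2 _ V) in hx. simpl in hx.
replace e with (@norm_factor _ V * (e / @norm_factor _ V)) by (field; lra).
exact hx.
Qed.

(** The Banach-Steinhaus theorem, filtered by [h -> 0]: convergence of [L h x] as
    [h -> 0] bounds it only for [h] in a neighbourhood that depends on [x].  The
    proof follows Baire: were there no uniform bound, there would be nested
    balls, on the (n+1)-st of which some [L h] with [h] within [/ (n + 1)] of
    [0] exceeds [n] in norm; this contradicts the pointwise bound at the limit of
    the balls. *)
Lemma banach_steinhaus_at_zero (D : R -> Prop) (L : R -> V -> V) :
  (forall h, D h -> is_linear (L h)) ->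
  (forall x, exists d M, 0 < d /\
     forall h, D h -> Rabs h < d -> norm (L h x) <= M) ->
  exists d M, 0 < d /\ 0 < M /\
    forall h, D h -> Rabs h < d -> forall x, norm (L h x) <= M * norm x.
Proof.
intros hlin hpt. apply NNPP; intro hno.
set (inball := fun (p : V * posreal) x => norm (minus x (fst p)) < snd p).
(* A bound on some ball around [c] would give one on a ball around [0] by
   translation, hence a uniform one: so [L h] is large somewhere in every ball,
   and then on a smaller ball by continuity. *)
assert (step : forall (p : V * posreal) (n : nat), exists q : V * posreal,
    (forall x, inball q x -> inball p x) /\ snd q <= snd p / 2 /\
    exists h, D h /\ Rabs h < / (INR n + 1) /\
      forall x, inball q x -> INR n < norm (L h x)).
{ intros [c [r hr]] n.
  assert (large : exists h y, D h /\ Rabs h < / (INR n + 1) /\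
      norm (minus y c) < r / 2 /\ INR n < norm (L h y)).
  { apply NNPP; intro hsmall. apply hno.
    exists (/ (INR n + 1)), (8 * (INR n + 1) / r).
    assert (hn := pos_INR n).
    split; [apply Rinv_0_lt_compat; lra|].
    split; [apply Rdiv_lt_0_compat; lra|].
    intros h hD hh x.
    assert (hs : forall y, norm (minus y c) < r / 2 -> norm (L h y) <= INR n).
    { intros y hy. apply Rnot_lt_le; intro hlt. apply hsmall.
      now exists h, y. }
    destruct (Req_dec (norm x) 0) as [h0|hx0].
    { rewrite (norm_eq_zero x h0) (linear_zero (L h) (hlin h hD)).
      rewrite norm_zero; lra. }
    assert (hx : 0 < norm x) by (pose proof (norm_ge_0 x); lra).
    set (k := r / (4 * norm x)).
    assert (hk : 0 < k) by (apply Rdiv_lt_0_compat; lra).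
    assert (hc : norm (L h c) <= INR n).
    { apply hs. rewrite norm_minus_self. lra. }
    assert (hcx : norm (L h (plus (rscal k x) c)) <= INR n).
    { apply hs. rewrite minus_plus_cancel norm_rscal Rabs_pos_eq ; [|lra].
      replace (k * norm x) with (r / 4) by (unfold k; field; lra). lra. }
    rewrite linear_plus ?linear_rscal in hcx; [|auto ..].
    assert (hkx : k * norm (L h x) <= 2 * INR n).
    { rewrite -(Rabs_pos_eq k); [|lra]. rewrite -norm_rscal.
      replace (rscal k (L h x))
        with (minus (plus (rscal k (L h x)) (L h c)) (L h c)).
      - eapply Rle_trans; [apply norm_minus_le|lra].
      - now rewrite minus_plus_cancel. }
    apply Rmult_le_reg_l with k; [exact hk|].
    replace (k * (8 * (INR n + 1) / r * norm x)) with (2 * (INR n + 1))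
      by (unfold k; field; lra).
    lra. }
  destruct large as [h [y [hD [hh [hy hLy]]]]].
  destruct (linear_norm _ (hlin h hD)) as [M [hM hLM]].
  set (g := (norm (L h y) - INR n) / M).
  assert (hg : 0 < g) by (apply Rdiv_lt_0_compat; lra).
  assert (hr' : 0 < Rmin (r / 2) g) by (apply Rmin_pos; lra).
  exists (y, mkposreal _ hr'). unfold inball; simpl.
  pose proof (Rmin_l (r / 2) g). pose proof (Rmin_r (r / 2) g).
  repeat split.
  - intros x hx. pose proof (norm_minus_le_via y x c). lra.
  - lra.
  - exists h. repeat split; [exact hD|exact hh|].
    intros x hx.
    assert (hLxy : norm (L h (minus y x)) <= M * norm (minus y x)) by apply hLM.
    rewrite linear_minus in hLxy; [|auto].
    rewrite norm_minus_sym in hx.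
    assert (M * norm (minus y x) < norm (L h y) - INR n).
    { replace (norm (L h y) - INR n) with (M * g) by (unfold g; field; lra).
      apply Rmult_lt_compat_l; lra. }
    pose proof (norm_le_minus (L h y) (L h x)). lra. }
pose (next := fun p n => proj1_sig (constructive_indefinite_description _ (step p n))).
pose (balls := fix balls n := match n with
  | O => (zero : V, mkposreal 1 Rlt_0_1)
  | S n => next (balls n) n end).
assert (hnext : forall n,
    (forall x, inball (balls (S n)) x -> inball (balls n) x) /\
    snd (balls (S n)) <= snd (balls n) / 2 /\
    exists h, D h /\ Rabs h < / (INR n + 1) /\
      forall x, inball (balls (S n)) x -> INR n < norm (L h x)).
{ intros n. exact (proj2_sig (constructive_indefinite_description _ (step (balls n) n))). }
assert (center : forall n, inball (balls n) (fst (balls n))).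
{ intros n. unfold inball. rewrite norm_minus_self. apply cond_pos. }
assert (radius : forall n, snd (balls n) <= (/ 2) ^ n).
{ induction n as [|n IH]; [simpl; lra|].
  destruct (hnext n) as [_ [h _]].
  change ((/ 2) ^ S n) with (/ 2 * (/ 2) ^ n). lra. }
destruct (cantor_intersection (fun n => inball (balls n))) as [z hz].
- intros n. apply hnext.
- intros n. exists (fst (balls n)). apply center.
- intros e he.
  destruct (pow_lt_1_zero (/ 2)) with (y := e) as [n hn];
    [rewrite Rabs_pos_eq; lra|lra|].
  exists n, (fst (balls n)). intros x hx. unfold inball in hx.
  pose proof (radius n). specialize (hn n (le_n n)).
  pose proof (Rle_abs ((/ 2) ^ n)). lra.
- destruct (hpt z) as [d [M [hd hM]]].
  (* The balls are open, so [z] may miss the n-th one; points of later balls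
     close to [z] still give [norm (L h z) > n - 1], and [M + 1 < n]. *)
  destruct (INR_unbounded (Rabs M + 1 + / d)) as [n hn].
  destruct (hnext n) as [_ [_ [h [hD [hh hL]]]]].
  assert (hd' : 0 < / d) by now apply Rinv_0_lt_compat.
  assert (hMp := Rabs_pos M). assert (hMM := Rle_abs M).
  assert (hhd : Rabs h < d).
  { apply Rlt_trans with (1 := hh). rewrite -(Rinv_inv d).
    apply Rinv_lt_contravar; [apply Rmult_lt_0_compat|]; lra. }
  specialize (hM h hD hhd).
  destruct (linear_norm _ (hlin h hD)) as [K [hK hLK]].
  destruct (hz (/ K)) as [m hm]; [now apply Rinv_0_lt_compat|].
  set (x := fst (balls (m + S n)%nat)).
  assert (hxm : norm (minus x z) < / K).
  { apply hm, (decreasing_sets (fun n => inball (balls n))) with (n := S n).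
    - intros k. apply hnext.
    - rewrite Nat.add_comm. apply center. }
  assert (hxn : INR n < norm (L h x)).
  { apply hL, (decreasing_sets (fun n => inball (balls n))) with (n := m).
    - intros k. apply hnext.
    - apply center. }
  specialize (hLK (minus x z)). rewrite linear_minus in hLK; [|auto].
  assert (K * norm (minus x z) < 1).
  { replace 1 with (K * / K) by (field; lra). now apply Rmult_lt_compat_l. }
  pose proof (norm_le_minus (L h x) (L h z)). lra.
Qed.

End Completeness.

(** * Compact operators *)

Section Compactness.

Context {X : CompleteNormedModule C_AbsRing}.
Local Notation V := (CompleteNormedModule.NormedModule C_AbsRing X).
Implicit Types (x y z : V).

Definition precompact (S : V -> Prop) : Prop :=
  forall e, 0 < e -> exists l : list V,
    forall x, S x -> exists y, In y l /\ norm (minus x y) < e.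

Lemma precompact_of_compact_closure (S : V -> Prop) :
  compact_set (closure S) -> precompact S.
Proof.
intros hS e he.
destruct (hS (fun O => exists c : V, O = fun y => norm (minus y c) < e))
  as [l [hl hcov]].
- intros O [c ->]. apply (open_norm_ball c e).
- intros x _. exists (fun y => norm (minus y x) < e). split; [now exists x|].
  now rewrite norm_minus_self.
- assert (centers : exists lc : list V, forall O, In O l ->
      exists c, In c lc /\ O = fun y => norm (minus y c) < e).
  { clear hcov. induction l as [|O l IH]; [now exists nil|].
    destruct IH as [lc hlc]; [intros O' h; apply hl; now right|].
    destruct (hl O (or_introl eq_refl)) as [c hc].
    exists (c :: lc). intros O' [<-|h].
    - exists c. split; [now left|exact hc].
    - destruct (hlc O' h) as [c' [h1 h2]]. exists c'. split; [now right|exact h2]. }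
  destruct centers as [lc hlc]. exists lc. intros x hx.
  destruct (hcov x) as [O [hO hOx]].
  { intros P hP. exists x. split; [exact (locally_singleton _ _ hP)|exact hx]. }
  destruct (hlc O hO) as [c [hc ->]]. now exists c.
Qed.

(** If an open cover had no finite subcover, then repeatedly cutting the set into
    finitely many pieces of diameter tending to [0], and keeping one that is
    still not finitely covered, would yield shrinking sets.  By completeness they
    converge to a point; the member of the cover around it contains a whole such
    set. *)
Lemma compact_closure_of_precompact (S : V -> Prop) :
  precompact S -> compact_set (closure S).
Proof.
intros hS cover hopen hcover.
set (good := fun E : V -> Prop => exists l,
  (forall O, In O l -> cover O) /\ (forall x, E x -> exists O, In O l /\ O x)).
apply NNPP; intro hbad. change (~ good (closure S)) in hbad.
set (cut := fun (E : V -> Prop) n c x =>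
  E x /\ norm (minus x c) < / (INR n + 1)).
assert (step : forall E n, (forall x, E x -> closure S x) -> ~ good E ->
    exists c, ~ good (cut E n c)).
{ intros E n hES hE. apply NNPP; intro hno. apply hE.
  assert (he : 0 < / (INR n + 1)).
  { apply Rinv_0_lt_compat. pose proof (pos_INR n). lra. }
  destruct (hS (/ (INR n + 1) / 2)) as [l hl]; [lra|].
  assert (hgood : good (fun x => exists c, In c l /\ cut E n c x)).
  { clear hl. induction l as [|c l [l1 [h1 h1']]].
    - exists nil. split; [easy|]. now intros x [c [[] _]].
    - destruct (NNPP (good (cut E n c))) as [l2 [h2 h2']].
      { intro h. apply hno. now exists c. }
      exists (l1 ++ l2)%list. split.
      + intros O hO. apply in_app_or in hO. destruct hO; auto.
      + intros x [c' [[<-|hc'] hx]].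
        * destruct (h2' x hx) as [O [hO hOx]]. exists O. split; [|exact hOx].
          apply in_or_app. now right.
        * destruct (h1' x) as [O [hO hOx]]; [now exists c'|].
          exists O. split; [|exact hOx]. apply in_or_app. now left. }
  destruct hgood as [l' [h1 h2]]. exists l'. split; [exact h1|].
  intros x hx. apply h2.
  destruct (hES x hx (fun y => norm (minus y x) < / (INR n + 1) / 2))
    as [y [hyx hy]].
  { apply locally_normP. exists (/ (INR n + 1) / 2). split; [lra|auto]. }
  destruct (hl y hy) as [c [hc hyc]]. exists c. split; [exact hc|].
  split; [exact hx|]. rewrite norm_minus_sym in hyx.
  pose proof (norm_minus_le_via y x c). lra. }
pose (center E n := epsilon (inhabits (zero : V)) (fun c => ~ good (cut E n c))).
pose (E := fix E n := match n with
  | O => closure S : V -> Prop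
  | S n => cut (E n) n (center (E n) n) end).
assert (hE : forall n, (forall x, E n x -> closure S x) /\ ~ good (E n)).
{ induction n as [|n [IH1 IH2]]; [split; [auto|exact hbad]|]. split.
  - intros x [hx _]. auto.
  - exact (epsilon_spec _ _ (step (E n) n IH1 IH2)). }
assert (nonempty : forall n, exists x, E n x).
{ intros n. apply NNPP; intro h. apply (proj2 (hE n)). exists nil.
  split; [easy|]. intros x hx. exfalso. apply h. now exists x. }
destruct (cantor_intersection E) as [z hz].
- now intros n x [hx _].
- exact nonempty.
- intros e he. destruct (INR_unbounded (/ e)) as [n hn].
  exists (Datatypes.S n), (center (E n) n). intros x [_ hx].
  assert (0 < / e) by now apply Rinv_0_lt_compat.
  apply Rlt_trans with (1 := hx). rewrite -(Rinv_inv e).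
  apply Rinv_lt_contravar; [apply Rmult_lt_0_compat|]; lra.
- destruct (hcover z) as [O [hO hOz]].
  { intros P hP. apply locally_normP in hP. destruct hP as [e [he hP]].
    destruct (hz e he) as [n hn]. destruct (nonempty n) as [x hx].
    destruct (proj1 (hE n) x hx (fun y => norm (minus y z) < e)) as [y [hy hSy]].
    { apply (open_norm_ball z e), hn, hx. }
    exists y. auto. }
  apply (hopen O hO) in hOz. apply locally_normP in hOz.
  destruct hOz as [e [he hOe]]. destruct (hz e he) as [n hn].
  apply (proj2 (hE n)). exists (O :: nil). split.
  + now intros O' [<-|[]].
  + intros x hx. exists O. split; [now left|]. apply hOe, hn, hx.
Qed.

Definition unit_image (L : V -> V) y : Prop := exists x, norm x <= 1 /\ y = L x.

Lemma compact_operatorP (L : V -> V) :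
  @compact_operator X L <-> precompact (unit_image L).
Proof.
split.
- exact (precompact_of_compact_closure (unit_image L)).
- exact (compact_closure_of_precompact (unit_image L)).
Qed.

Lemma precompact_image_plus (L M : V -> V) :
  precompact (unit_image L) -> precompact (unit_image M) ->
  precompact (unit_image (fun x => plus (L x) (M x))).
Proof.
intros hL hM e he.
destruct (hL (e / 2)) as [l1 h1]; [lra|].
destruct (hM (e / 2)) as [l2 h2]; [lra|].
exists (map (fun p => plus (fst p) (snd p)) (list_prod l1 l2)).
intros y [x [hx ->]].
destruct (h1 (L x)) as [a [ha ha']]; [now exists x|].
destruct (h2 (M x)) as [b [hb hb']]; [now exists x|].
exists (plus a b). split.
- apply (in_map (fun p => plus (fst p) (snd p)) _ (a, b)). now apply in_prod.
- rewrite minus_plus_plus. eapply Rle_lt_trans; [apply norm_triangle|lra].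
Qed.

Lemma precompact_image_comp (L M : V -> V) :
  is_linear M -> precompact (unit_image L) ->
  precompact (unit_image (fun x => M (L x))).
Proof.
intros hM hL e he.
destruct (linear_norm _ hM) as [K [hK hMK]].
destruct (hL (e / K)) as [l hl]; [now apply Rdiv_lt_0_compat|].
exists (map M l). intros y [x [hx ->]].
destruct (hl (L x)) as [a [ha ha']]; [now exists x|].
exists (M a). split; [now apply in_map|].
rewrite -linear_minus; [|exact hM]. eapply Rle_lt_trans; [apply hMK|].
replace e with (K * (e / K)) by (field; lra). now apply Rmult_lt_compat_l.
Qed.

Lemma precompact_image_zero : precompact (unit_image (fun _ => zero)).
Proof.
intros e he. exists (zero :: nil). intros y [x [_ ->]].
exists zero. split; [now left|]. now rewrite norm_minus_self.
Qed.

End Compactness.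

(** * Strongly continuous semigroups *)

Section Semigroups.

Context {X : CompleteNormedModule C_AbsRing}.
Local Notation V := (CompleteNormedModule.NormedModule C_AbsRing X).
Implicit Types (x y z : V).

Lemma semigroup_right_continuous (T : R -> V -> V) :
  @C0_semigroup X T -> forall x e, 0 < e ->
  exists d, 0 < d /\ forall h, 0 <= h < d -> norm (minus (T h x) x) < e.
Proof.
intros [_ [T0 [_ Tc]]] x e he.
destruct (filterlim_at_right_norm (X := V) (fun t => T t x) 0 x (Tc x) e he)
  as [d [hd h]].
exists d. split; [exact hd|]. intros t ht.
destruct (Req_dec t 0) as [->|].
- rewrite T0 norm_minus_self. exact he.
- rewrite -(Rplus_0_l t). apply h. lra.
Qed.

(** Strong continuity at [0] gives a bound on some [[0, d)], and the semigroup law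
    propagates it to bounded intervals. *)
Lemma semigroup_bounded (T : R -> V -> V) (b : R) :
  @C0_semigroup X T ->
  exists M, 0 < M /\
    forall t, 0 <= t <= b -> forall x, norm (T t x) <= M * norm x.
Proof.
intros hT. pose proof hT as [Tlin [T0 [Tadd _]]].
destruct (banach_steinhaus_at_zero (fun h => 0 <= h) T) as [d [M [hd [hM hTM]]]].
{ exact Tlin. }
{ intros x. destruct (semigroup_right_continuous T hT x 1 Rlt_0_1) as [d [hd h]].
  exists d, (1 + norm x). split; [exact hd|]. intros t ht htd.
  rewrite Rabs_pos_eq in htd; [|exact ht].
  pose proof (h t (conj ht htd)). pose proof (norm_le_minus (T t x) x). lra. }
assert (iter : forall n t, 0 <= t <= INR n * (d / 2) ->
    forall x, norm (T t x) <= (Rmax 1 M) ^ n * norm x).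
{ pose proof (Rmax_l 1 M). pose proof (Rmax_r 1 M).
  induction n as [|n IH]; intros t ht x.
  - simpl in ht. replace t with 0 by lra. rewrite T0. simpl. lra.
  - rewrite S_INR in ht.
    set (r := Rmin t (d / 2)).
    assert (hr : 0 <= r < d /\ 0 <= t - r <= INR n * (d / 2)).
    { pose proof (pos_INR n) as hn. assert (0 <= INR n * (d / 2)).
      { apply Rmult_le_pos; lra. }
      unfold r. apply Rmin_case_strong; lra. }
    replace t with (r + (t - r)) by ring. rewrite Tadd; [|lra|lra].
    apply Rle_trans with (Rmax 1 M * norm (T (t - r) x)).
    + eapply Rle_trans; [apply hTM; [lra|rewrite Rabs_pos_eq; lra]|].
      apply Rmult_le_compat_r; [apply norm_ge_0|lra].
    + simpl. rewrite Rmult_assoc. apply Rmult_le_compat_l; [lra|].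
      apply IH. lra. }
destruct (INR_unbounded (b / (d / 2))) as [n hn].
exists (Rmax 1 M ^ n). split.
- apply pow_lt. pose proof (Rmax_l 1 M). lra.
- intros t ht. apply iter. split; [lra|].
  apply Rle_trans with (1 := proj2 ht).
  replace b with (b / (d / 2) * (d / 2)) by (field; lra).
  apply Rmult_le_compat_r; lra.
Qed.

Lemma semigroup_continuous (T : R -> V -> V) :
  @C0_semigroup X T -> forall t x e, 0 <= t -> 0 < e ->
  exists d, 0 < d /\ forall r, 0 <= r -> Rabs (r - t) < d ->
    norm (minus (T r x) (T t x)) < e.
Proof.
intros hT t x e ht he. pose proof hT as [Tlin [T0 [Tadd _]]].
destruct (semigroup_bounded T t hT) as [M [hM hTM]].
destruct (semigroup_right_continuous T hT x (e / M)) as [d [hd h]].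
{ now apply Rdiv_lt_0_compat. }
assert (shift : forall a k, 0 <= a <= t -> 0 <= k < d ->
    norm (minus (T (a + k) x) (T a x)) < e).
{ intros a k ha hk. rewrite Tadd; [|lra|lra]. rewrite -linear_minus; [|apply Tlin; lra].
  eapply Rle_lt_trans; [apply hTM, ha|].
  replace e with (M * (e / M)) by (field; lra).
  apply Rmult_lt_compat_l; [exact hM|]. apply h, hk. }
exists d. split; [exact hd|]. intros r hr hrt. apply Rabs_def2 in hrt.
destruct (Rle_or_lt t r) as [htr|htr].
- replace r with (t + (r - t)) by ring. apply shift; lra.
- rewrite norm_minus_sym.
  replace (T t x) with (T (r + (t - r)) x) by (f_equal; ring). apply shift; lra.
Qed.

(** The difference quotients at [t] converge strongly, hence are uniformly
    bounded near [0], which makes [T] Lipschitz in operator norm at [t]. *)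
Lemma norm_continuous_of_differentiable (T : R -> V -> V) :
  @C0_semigroup X T -> @immediately_differentiable X T ->
  forall t e, 0 < t -> 0 < e ->
  exists d, 0 < d /\ forall r, Rabs (r - t) < d ->
    forall x, norm x <= 1 -> norm (minus (T r x) (T t x)) <= e.
Proof.
intros [Tlin _] hdiff t e ht he.
set (D := fun h => h <> 0 /\ 0 < t + h).
set (L := fun h x => rscal (/ h) (minus (T (t + h) x) (T t x))).
destruct (banach_steinhaus_at_zero D L) as [d [M [hd [hM hLM]]]].
{ intros h [_ hh]. unfold L. apply is_linear_rscal_comp, is_linear_minus_fun.
  - apply Tlin. lra.
  - apply Tlin. lra. }
{ intros x. destruct (hdiff x t ht) as [y hy].
  destruct (hy (fun z => norm (minus z y) < 1)) as [d hd].
  { apply (locally_normP (X := V)). exists 1. split; [lra|auto]. }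
  exists d, (1 + norm y). split; [apply cond_pos|]. intros h [h0 _] hh.
  assert (hLy : norm (minus (L h x) y) < 1).
  { apply (hd h); [|exact h0]. change (Rabs (h - 0) < d). now rewrite Rminus_0_r. }
  pose proof (norm_le_minus (L h x) y). lra. }
set (d' := Rmin d (Rmin t (e / M))).
assert (hd' : 0 < d' /\ d' <= d /\ d' <= t /\ d' <= e / M).
{ pose proof (Rmin_l d (Rmin t (e / M))). pose proof (Rmin_r d (Rmin t (e / M))).
  pose proof (Rmin_l t (e / M)). pose proof (Rmin_r t (e / M)).
  unfold d'. repeat split; [|lra|lra|lra].
  repeat apply Rmin_pos; [exact hd|exact ht|now apply Rdiv_lt_0_compat]. }
exists d'. split; [apply hd'|]. intros r hr x hx.
destruct (Req_dec r t) as [->|hrt]; [rewrite norm_minus_self; lra|].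
assert (h0 := Rminus_eq_contra r t hrt).
set (h := r - t) in *. pose proof (Rabs_def2 _ _ hr).
assert (hLh : norm (L h x) <= M * norm x).
{ apply hLM; [split; [exact h0|lra]|lra]. }
replace (minus (T r x) (T t x)) with (rscal h (L h x)).
- rewrite norm_rscal.
  apply Rle_trans with (e / M * (M * 1)); [|right; field; lra].
  apply Rmult_le_compat; [apply Rabs_pos|apply norm_ge_0|lra|].
  eapply Rle_trans; [exact hLh|]. apply Rmult_le_compat_l; lra.
- unfold L. rewrite rscal_mult Rinv_r; [|exact h0].
  rewrite rscal_1. replace (t + h) with r by (unfold h; ring). reflexivity.
Qed.

(** For [y] in the common domain, [(S h y - T h y) / h] tends to
    [(A + B) y - A y = B y]. *)
Lemma generator_perturbation (A : operator X) (B : V -> V) (T S : R -> V -> V) y :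
  @C0_semigroup X T -> @C0_semigroup X S ->
  is_generator A T -> is_generator (op_add A B) S -> op_dom A y ->
  forall e, 0 < e -> exists d, 0 < d /\ forall h, 0 < h < d ->
    norm (minus (minus (S h y) (T h y)) (rscal h (B y))) <= e * h.
Proof.
intros [_ [T0 _]] [_ [S0 _]] [_ hA] [_ hAB] hy e he.
destruct (filterlim_at_right_norm (X := V) _ _ _ (hA y hy) (e / 2))
  as [d1 [hd1 h1]]; [lra|].
destruct (filterlim_at_right_norm (X := V) _ _ _ (hAB y hy) (e / 2))
  as [d2 [hd2 h2]]; [lra|].
exists (Rmin d1 d2). split; [now apply Rmin_pos|]. intros h hh.
pose proof (Rmin_l d1 d2). pose proof (Rmin_r d1 d2).
specialize (h1 h ltac:(lra)). specialize (h2 h ltac:(lra)).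
rewrite Rplus_0_l in h1. rewrite Rplus_0_l in h2.
unfold diff_quotient in h1, h2. rewrite Rplus_0_l T0 in h1. rewrite Rplus_0_l S0 in h2.
set (qT := rscal (/ h) (minus (T h y) y)).
set (qS := rscal (/ h) (minus (S h y) y)).
change (norm (minus qT (op_fun A y)) < e / 2) in h1.
change (norm (minus qS (plus (op_fun A y) (B y))) < e / 2) in h2.
replace (minus (minus (S h y) (T h y)) (rscal h (B y)))
  with (rscal h (minus (minus qS (plus (op_fun A y) (B y)))
                       (minus qT (op_fun A y)))).
- rewrite norm_rscal Rabs_pos_eq; [|lra]. rewrite Rmult_comm.
  apply Rmult_le_compat_r; [lra|].
  eapply Rle_trans; [apply norm_minus_le|lra].
- rewrite minus_minus_minus rscal_minus. f_equal; [|f_equal].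
  + unfold qS, qT. rewrite rscal_minus !rscal_mult Rinv_r; [|lra].
    rewrite !rscal_1 minus_minus_minus minus_eq_zero. apply minus_zero_r.
  + rewrite (plus_comm (op_fun A y)). apply (minus_plus_cancel (G := V)).
Qed.

(** Mean value inequality.  A right derivative is enough because real induction
    only ever moves to the right.  Proving the bound up to an additive error lets
    it leave [a], where only continuity is assumed. *)
Lemma mean_value_inequality (g : R -> V) (w : V) (a b c : R) :
  a <= b -> 0 <= c ->
  (forall s, a <= s <= b -> forall e, 0 < e -> exists d, 0 < d /\
     forall r, a <= r <= b -> Rabs (r - s) < d -> norm (minus (g r) (g s)) < e) ->
  (forall s, a < s < b -> forall e, 0 < e -> exists d, 0 < d /\
     forall h, 0 < h < d -> s + h <= b ->
       norm (minus (minus (g s) (g (s + h))) (rscal h w)) <= (c + e) * h) ->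
  norm (minus (minus (g a) (g b)) (rscal (b - a) w)) <= c * (b - a).
Proof.
intros hab hc hcont hder.
set (F := (fun s => minus (minus (g a) (g s)) (rscal (s - a) w)) : R -> V).
change (norm (F b) <= c * (b - a)).
assert (incr : forall s r, minus (F r) (F s) =
    minus (minus (g s) (g r)) (rscal (r - s) w)).
{ intros s r. unfold F. replace (r - a) with ((r - s) + (s - a)) by ring.
  rewrite rscal_plus_l (minus_trans (g s) (g a) (g r)) (plus_comm (minus (g a) (g s))).
  now rewrite (minus_plus_plus (minus (g s) (g r))) minus_plus_cancel. }
assert (Fcont : forall s, a <= s <= b -> forall e, 0 < e -> exists d, 0 < d /\
    forall r, a <= r <= b -> Rabs (r - s) < d -> norm (minus (F r) (F s)) <= e).
{ intros s hs e he.
  destruct (hcont s hs (e / 2)) as [d [hd h]]; [lra|].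
  assert (hw := norm_ge_0 w).
  assert (hd' : 0 < e / (2 * (norm w + 1))) by (apply Rdiv_lt_0_compat; lra).
  exists (Rmin d (e / (2 * (norm w + 1)))). split; [now apply Rmin_pos|].
  intros r hr hrs.
  pose proof (Rmin_l d (e / (2 * (norm w + 1)))).
  pose proof (Rmin_r d (e / (2 * (norm w + 1)))).
  rewrite incr. eapply Rle_trans; [apply norm_minus_le|].
  rewrite norm_minus_sym norm_rscal.
  specialize (h r hr ltac:(lra)).
  assert (Rabs (r - s) * norm w <= e / (2 * (norm w + 1)) * (norm w + 1)).
  { apply Rmult_le_compat; [apply Rabs_pos|exact hw|lra|lra]. }
  replace (e / (2 * (norm w + 1)) * (norm w + 1)) with (e / 2) in *
    by (field; lra).
  lra. }
assert (Fa : F a = zero).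
{ unfold F. now rewrite Rminus_diag rscal_0 !minus_eq_zero. }
apply le_epsilon. intros e0 he0.
set (e := e0 / (b - a + 1)).
assert (he : 0 < e) by (apply Rdiv_lt_0_compat; lra).
replace (c * (b - a) + e0) with ((c + e) * (b - a) + e) by (unfold e; field; lra).
apply (real_induction (fun s => norm (F s) <= (c + e) * (s - a) + e) a b hab).
- rewrite Fa norm_zero. lra.
- intros s hs Ps. destruct (Req_dec s a) as [->|hsa].
  + destruct (Fcont a ltac:(lra) e he) as [d [hd h]].
    exists d. split; [exact hd|]. intros v hv hvb.
    specialize (h v ltac:(lra) ltac:(rewrite Rabs_pos_eq; lra)).
    rewrite Fa minus_zero_r in h.
    assert (0 <= (c + e) * (v - a)) by (apply Rmult_le_pos; lra). lra.
  + destruct (hder s ltac:(lra) e he) as [d [hd h]].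
    exists d. split; [exact hd|]. intros v hv hvb.
    specialize (h (v - s) ltac:(lra) ltac:(lra)).
    replace (s + (v - s)) with v in h by ring. rewrite -incr in h.
    pose proof (norm_le_minus (F v) (F s)). lra.
- intros s hs Pr. apply le_epsilon. intros e' he'.
  destruct (Fcont s ltac:(lra) e' he') as [d [hd h]].
  set (r := Rmax a (s - d / 2)).
  assert (hr : a <= r < s /\ s - d / 2 <= r).
  { unfold r. split; [split; [apply Rmax_l|apply Rmax_lub_lt; lra]|apply Rmax_r]. }
  specialize (h r ltac:(lra) ltac:(apply Rabs_def1; lra)).
  specialize (Pr r ltac:(lra)). rewrite norm_minus_sym in h.
  assert ((c + e) * (r - a) <= (c + e) * (s - a)) by (apply Rmult_le_compat_l; lra).
  pose proof (norm_le_minus (F s) (F r)). lra.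
Qed.

End Semigroups.

(** * The variation of constants formula *)

Section Perturbation.

Context {X : CompleteNormedModule C_AbsRing}.
Local Notation V := (CompleteNormedModule.NormedModule C_AbsRing X).
Implicit Types (x y z : V).

Lemma semigroup_range_in_domain (A : operator X) (T : R -> V -> V) s x :
  @C0_semigroup X T -> is_generator A T -> @immediately_differentiable X T ->
  0 < s -> op_dom A (T s x).
Proof.
intros [_ [T0 [Tadd _]]] [hdom _] hdiff hs.
apply hdom. destruct (hdiff x s hs) as [y hy]. exists y.
intros P hP. destruct (hy P hP) as [d hd]. exists d.
intros h hball hh. assert (hPh := hd h hball). specialize (hPh (Rgt_not_eq _ _ hh)).
unfold diff_quotient in *. rewrite Rplus_0_l.
rewrite T0 -Tadd; [|lra|lra]. now rewrite Rplus_comm.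
Qed.

Lemma semigroup_uniform_on_precompact (S : R -> V -> V) (P : V -> Prop) t e :
  @C0_semigroup X S -> precompact P -> 0 <= t -> 0 < e ->
  exists d, 0 < d /\ forall r, 0 <= r -> Rabs (r - t) < d ->
    forall y, P y -> norm (minus (S r y) (S t y)) <= e.
Proof.
intros hS hP ht he. pose proof hS as [Slin _].
destruct (semigroup_bounded S (t + 1) hS) as [M [hM hSM]].
destruct (hP (e / (3 * M))) as [l hl]; [apply Rdiv_lt_0_compat; lra|].
assert (net : exists d, 0 < d /\ forall r, 0 <= r -> Rabs (r - t) < d ->
    forall a, In a l -> norm (minus (S r a) (S t a)) < e / 3).
{ clear hl. induction l as [|a l [d1 [hd1 h1]]].
  - exists 1. split; [lra|]. now intros r _ _ a [].
  - destruct (semigroup_continuous S hS t a (e / 3)) as [d2 [hd2 h2]]; [lra|lra|].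
    exists (Rmin d1 d2). split; [now apply Rmin_pos|].
    pose proof (Rmin_l d1 d2). pose proof (Rmin_r d1 d2).
    intros r hr hrt b [<-|hb]; [apply h2; lra|apply h1; [lra|lra|exact hb]]. }
destruct net as [d [hd hnet]]. exists (Rmin d 1). split; [apply Rmin_pos; lra|].
intros r hr hrt y hy. pose proof (Rmin_l d 1). pose proof (Rmin_r d 1).
destruct (hl y hy) as [a [ha hya]].
assert (close : forall q, 0 <= q <= t + 1 -> norm (minus (S q y) (S q a)) <= e / 3).
{ intros q hq. rewrite -linear_minus; [|apply Slin; lra].
  eapply Rle_trans; [apply hSM, hq|].
  replace (e / 3) with (M * (e / (3 * M))) by (field; lra).
  apply Rmult_le_compat_l; lra. }
assert (hr1 : 0 <= r <= t + 1).
{ destruct (Rabs_def2 _ _ hrt). lra. }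
specialize (hnet r hr ltac:(lra) a ha).
pose proof (close r hr1). pose proof (close t ltac:(lra)) as h3.
rewrite norm_minus_sym in h3.
pose proof (norm_minus_le_via (S r a) (S r y) (S t y)).
pose proof (norm_minus_le_via (S t a) (S r a) (S t y)). lra.
Qed.

Context (A : operator X) (B : V -> V) (T S : R -> V -> V).
Context (hT : @C0_semigroup X T) (hS : @C0_semigroup X S).
Context (hA : is_generator A T) (hAB : is_generator (op_add A B) S).
Context (hdiff : @immediately_differentiable X T) (hB : is_linear B).

(** What [S t x - T t x = int_0^t S (t - r) B (T r x) dr] says about one interval
    of a Riemann sum.  As [T r x] lies in the domain of the generator for every
    [x], [r |-> S (t - r) (T r x)] has right derivative [- S (t - r) B (T r x)],
    and the mean value inequality applies. *)
Lemma variation_of_constants_estimate t u v c (w x : V) :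
  0 <= u <= v -> v <= t -> 0 <= c ->
  (forall r, u < r < v -> norm (minus (S (t - r) (B (T r x))) w) <= c) ->
  norm (minus (minus (S (t - u) (T u x)) (S (t - v) (T v x))) (rscal (v - u) w))
    <= c * (v - u).
Proof.
intros huv hvt hc hw.
pose proof hT as [Tlin [T0 [Tadd _]]]. pose proof hS as [Slin [S0 [Sadd _]]].
destruct (semigroup_bounded S t hS) as [M [hM hSM]].
apply (mean_value_inequality (fun r => S (t - r) (T r x)) w u v c); [lra|exact hc| |].
- intros s hs e he.
  destruct (semigroup_continuous T hT s x (e / (2 * M))) as [d1 [hd1 h1]];
    [lra|apply Rdiv_lt_0_compat; lra|].
  destruct (semigroup_continuous S hS (t - s) (T s x) (e / 2)) as [d2 [hd2 h2]];
    [lra|lra|].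
  exists (Rmin d1 d2). split; [now apply Rmin_pos|]. intros r hr hrs.
  pose proof (Rmin_l d1 d2). pose proof (Rmin_r d1 d2).
  specialize (h1 r ltac:(lra) ltac:(lra)).
  specialize (h2 (t - r) ltac:(lra)).
  replace (t - r - (t - s)) with (s - r) in h2 by ring.
  rewrite (Rabs_minus_sym s r) in h2. specialize (h2 ltac:(lra)).
  eapply Rle_lt_trans; [apply (norm_minus_le_via (S (t - r) (T s x)))|].
  rewrite -linear_minus; [|apply Slin; lra].
  assert (norm (S (t - r) (minus (T r x) (T s x))) <= e / 2).
  { eapply Rle_trans; [apply hSM; lra|].
    replace (e / 2) with (M * (e / (2 * M))) by (field; lra).
    apply Rmult_le_compat_l; lra. }
  lra.
- intros s hs e he. set (y := T s x).
  assert (hy : op_dom A y) by (apply (semigroup_range_in_domain A T); auto; lra).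
  destruct (generator_perturbation A B T S y hT hS hA hAB hy (e / (2 * M)))
    as [d1 [hd1 h1]]; [apply Rdiv_lt_0_compat; lra|].
  destruct (semigroup_continuous S hS (t - s) (B y) (e / 2)) as [d2 [hd2 h2]];
    [lra|lra|].
  exists (Rmin d1 d2). split; [now apply Rmin_pos|]. intros h hh hhv.
  pose proof (Rmin_l d1 d2). pose proof (Rmin_r d1 d2).
  specialize (h1 h ltac:(lra)).
  set (q := t - (s + h)).
  specialize (h2 q ltac:(unfold q; lra)).
  replace (q - (t - s)) with (- h) in h2 by (unfold q; ring).
  rewrite Rabs_Ropp Rabs_pos_eq in h2; [|lra]. specialize (h2 ltac:(lra)).
  assert (hq : 0 <= q <= t) by (unfold q; lra).
  replace (S (t - s) y) with (S q (S h y)).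
  2: { rewrite -Sadd; [|lra|lra]. f_equal. unfold q. ring. }
  replace (T (s + h) x) with (T h y).
  2: { unfold y. rewrite -Tadd; [|lra|lra]. f_equal. ring. }
  rewrite -(linear_minus (S q)); [|apply Slin; lra].
  eapply Rle_trans; [apply (norm_minus_le_via (S q (rscal h (B y))))|].
  rewrite -(linear_minus (S q)); [|apply Slin; lra].
  rewrite (linear_rscal (S q)); [|apply Slin; lra].
  rewrite -rscal_minus norm_rscal Rabs_pos_eq; [|lra].
  apply Rle_trans with (M * (e / (2 * M) * h) + h * (e / 2 + c)).
  + apply Rplus_le_compat.
    * eapply Rle_trans; [apply hSM, hq|]. apply Rmult_le_compat_l; lra.
    * apply Rmult_le_compat_l; [lra|].
      eapply Rle_trans; [apply (norm_minus_le_via (S (t - s) (B y)))|].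
      specialize (hw s hs). fold y in hw. lra.
  + right. field. lra.
Qed.

Context (hBT : forall t, 0 < t -> precompact (unit_image (fun x => B (T t x)))).

(** [S] is only strongly continuous, but strong convergence of bounded families is
    uniform on the precompact image of the unit ball under [B T s]. *)
Lemma integrand_norm_continuous t s e :
  0 < s <= t -> 0 < e -> exists d, 0 < d /\ forall r, r <= t -> Rabs (r - s) < d ->
    forall x, norm x <= 1 ->
      norm (minus (S (t - r) (B (T r x))) (S (t - s) (B (T s x)))) <= e.
Proof.
intros hs he. pose proof hS as [Slin _].
destruct (semigroup_bounded S (t + 1) hS) as [M [hM hSM]].
destruct (linear_norm _ hB) as [K [hK hBK]].
assert (hMK : 0 < M * K) by now apply Rmult_lt_0_compat.
destruct (norm_continuous_of_differentiable T hT hdiff s (e / (2 * (M * K))))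
  as [d1 [hd1 h1]]; [lra|apply Rdiv_lt_0_compat; lra|].
destruct (semigroup_uniform_on_precompact S _ (t - s) (e / 2) hS (hBT s (proj1 hs)))
  as [d2 [hd2 h2]]; [lra|lra|].
exists (Rmin s (Rmin d1 d2)). split; [repeat apply Rmin_pos; lra|].
intros r hrt hrs x hx.
pose proof (Rmin_l s (Rmin d1 d2)). pose proof (Rmin_r s (Rmin d1 d2)).
pose proof (Rmin_l d1 d2). pose proof (Rmin_r d1 d2).
specialize (h1 r ltac:(lra) x hx).
specialize (h2 (t - r) ltac:(lra)).
replace (t - r - (t - s)) with (s - r) in h2 by ring.
rewrite (Rabs_minus_sym s r) in h2.
specialize (h2 ltac:(lra) (B (T s x)) ltac:(now exists x)).
destruct (Rabs_def2 _ _ hrs).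
eapply Rle_trans; [apply (norm_minus_le_via (S (t - r) (B (T s x))))|].
assert (norm (minus (S (t - r) (B (T r x))) (S (t - r) (B (T s x)))) <= e / 2);
  [|lra].
rewrite -linear_minus; [|apply Slin; lra]. rewrite -linear_minus; [|exact hB].
eapply Rle_trans; [apply hSM; lra|].
apply Rle_trans with (M * (K * (e / (2 * (M * K))))); [|right; field; lra].
apply Rmult_le_compat_l; [lra|]. eapply Rle_trans; [apply hBK|].
apply Rmult_le_compat_l; lra.
Qed.

(** The approximating operator is a Riemann sum of the integrand over a partition
    of [[a, t]], built from left to right. *)
Lemma increment_near_compact t a c :
  0 < a <= t -> 0 < c ->
  exists K : V -> V, is_linear K /\ precompact (unit_image K) /\
    forall x, norm x <= 1 ->
      norm (minus (minus (S (t - a) (T a x)) (S (t - t) (T t x))) (K x))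
        <= c * (t - a).
Proof.
intros ha hc. pose proof hT as [Tlin _]. pose proof hS as [Slin _].
set (P := fun s => exists K : V -> V, is_linear K /\ precompact (unit_image K) /\
  forall x, norm x <= 1 ->
    norm (minus (minus (S (t - a) (T a x)) (S (t - s) (T s x))) (K x))
      <= c * (s - a)).
assert (step : forall m s r, 0 < m <= t -> a <= s <= r -> r <= t ->
    (forall q x, s < q < r -> norm x <= 1 ->
      norm (minus (S (t - q) (B (T q x))) (S (t - m) (B (T m x)))) <= c) ->
    P s -> P r).
{ intros m s r hm hs hr hq [K [Klin [Kcpt hK]]].
  set (G := fun x => S (t - m) (B (T m x))).
  assert (Glin : is_linear G).
  { apply (is_linear_comp (fun x => B (T m x)) (S (t - m))); [|apply Slin; lra].
    apply (is_linear_comp (T m) B); [apply Tlin; lra|exact hB]. }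
  assert (Gcpt : precompact (unit_image G)).
  { apply (precompact_image_comp (fun x => B (T m x)) (S (t - m)));
      [apply Slin; lra|apply hBT; lra]. }
  exists (fun x => plus (rscal (r - s) (G x)) (K x)). split; [|split].
  - apply (is_linear_plus_fun (fun x => rscal (r - s) (G x)) K);
      [now apply is_linear_rscal_comp|exact Klin].
  - apply (precompact_image_plus (fun x => rscal (r - s) (G x)) K); [|exact Kcpt].
    apply (precompact_image_comp G (rscal (r - s))); [|exact Gcpt].
    apply is_linear_rscal_comp, is_linear_id.
  - intros x hx.
    rewrite (minus_trans (S (t - s) (T s x)) (S (t - a) (T a x))).
    rewrite (plus_comm (minus (S (t - a) (T a x)) _)).
    rewrite (minus_plus_plus (minus (S (t - s) (T s x)) _)).
    eapply Rle_trans; [apply norm_triangle|].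
    replace (c * (r - a)) with (c * (r - s) + c * (s - a)) by ring.
    apply Rplus_le_compat; [|apply hK, hx].
    apply variation_of_constants_estimate; [lra|exact hr|lra|].
    intros q hqs. now apply hq. }
apply (real_induction P a t); [lra| | |].
- exists (fun _ => zero). split; [apply is_linear_zero|split].
  + apply precompact_image_zero.
  + intros x _. rewrite !minus_eq_zero norm_zero. lra.
- intros s hs Ps.
  destruct (integrand_norm_continuous t s c) as [d [hd h]]; [lra|exact hc|].
  exists d. split; [exact hd|]. intros v hv hvt.
  apply (step s s v); [lra|lra|lra| |exact Ps].
  intros q x hq hx. apply h; [lra|rewrite Rabs_pos_eq; lra|exact hx].
- intros s hs Pr.
  destruct (integrand_norm_continuous t s c) as [d [hd h]]; [lra|exact hc|].
  set (r := Rmax a (s - d / 2)).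
  assert (hr : a <= r < s /\ s - d / 2 <= r).
  { unfold r. split; [split; [apply Rmax_l|apply Rmax_lub_lt; lra]|apply Rmax_r]. }
  apply (step s r s); [lra|lra|lra| |apply Pr; lra].
  intros q x hq hx. apply h; [lra|apply Rabs_def1; lra|exact hx].
Qed.

(** Near [0] the integrand need not be norm continuous, but it is bounded, so
    the integral over [[0, a]] is small in norm. *)
Lemma perturbed_minus_unperturbed_near_compact t e :
  0 < t -> 0 < e ->
  exists K : V -> V, is_linear K /\ precompact (unit_image K) /\
    forall x, norm x <= 1 -> norm (minus (minus (S t x) (T t x)) (K x)) <= e.
Proof.
intros ht he. pose proof hT as [_ [T0 _]]. pose proof hS as [_ [S0 _]].
destruct (semigroup_bounded S t hS) as [M [hM hSM]].
destruct (semigroup_bounded T t hT) as [N [hN hTN]].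
destruct (linear_norm _ hB) as [L [hL hBL]].
set (C := M * (L * (N * 1))).
assert (hC : 0 < C) by (unfold C; repeat apply Rmult_lt_0_compat; lra).
set (a := Rmin t (e / (2 * C))).
assert (ha : 0 < a) by (apply Rmin_pos; [lra|apply Rdiv_lt_0_compat; lra]).
assert (hat : a <= t) by apply Rmin_l.
assert (hae : a <= e / (2 * C)) by apply Rmin_r.
destruct (increment_near_compact t a (e / (2 * t))) as [K [Klin [Kcpt hK]]];
  [lra|apply Rdiv_lt_0_compat; lra|].
exists K. split; [exact Klin|]. split; [exact Kcpt|]. intros x hx.
specialize (hK x hx).
assert (hsmall : norm (minus (minus (S (t - 0) (T 0 x)) (S (t - a) (T a x)))
                         (rscal (a - 0) zero)) <= C * (a - 0)).
{ apply variation_of_constants_estimate; [lra|exact hat|lra|].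
  intros r hr. rewrite minus_zero_r. unfold C.
  eapply Rle_trans; [apply hSM; lra|]. apply Rmult_le_compat_l; [lra|].
  eapply Rle_trans; [apply hBL|]. apply Rmult_le_compat_l; [lra|].
  eapply Rle_trans; [apply hTN; lra|]. apply Rmult_le_compat_l; lra. }
rewrite T0 !Rminus_0_r in hsmall. rewrite Rminus_diag S0 in hK.
replace (rscal a zero) with (zero : V) in hsmall
  by (symmetry; exact (scal_zero_r _)).
rewrite minus_zero_r in hsmall.
assert (C * a <= e / 2).
{ replace (e / 2) with (C * (e / (2 * C))) by (field; lra).
  apply Rmult_le_compat_l; lra. }
assert (e / (2 * t) * (t - a) <= e / 2).
{ replace (e / 2) with (e / (2 * t) * t) by (field; lra).
  apply Rmult_le_compat_l; [|lra]. left. apply Rdiv_lt_0_compat; lra. }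
rewrite (minus_trans (S (t - a) (T a x)) (S t x)).
unfold minus at 1. rewrite -plus_assoc.
change (norm (plus (minus (S t x) (S (t - a) (T a x)))
  (minus (minus (S (t - a) (T a x)) (T t x)) (K x))) <= e).
eapply Rle_trans; [apply norm_triangle|lra].
Qed.

End Perturbation.

(** * Operator norm and distance to the compact operators *)

Section Distance.

Context {X : CompleteNormedModule C_AbsRing}.
Local Notation V := (CompleteNormedModule.NormedModule C_AbsRing X).
Implicit Types (x y z : V) (L K : V -> V).

(** A bound on the unit ball makes the supremum finite, so that taking its real
    part in [op_norm] loses nothing. *)
Lemma op_norm_lub L c :
  (forall x, norm x <= 1 -> norm (L x) <= c) ->
  is_lub_Rbar (fun r => exists x : V, norm x <= 1 /\ r = norm (L x))
    (@op_norm X L).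
Proof.
intros hL. unfold op_norm.
set (E := fun r => exists x : V, norm x <= 1 /\ r = norm (L x)).
pose proof (Lub_Rbar_correct E) as hlub.
change (Lub_Rbar _) with (Lub_Rbar E).
destruct hlub as [ub lub].
assert (h0 : E (norm (L zero))).
{ exists zero. split; [rewrite norm_zero; lra|reflexivity]. }
assert (hc : Rbar_le (Lub_Rbar E) c).
{ apply lub. intros r [x [hx ->]]. exact (hL x hx). }
specialize (ub _ h0) as hl.
destruct (Lub_Rbar E); [now split|destruct hc|destruct hl].
Qed.

Lemma op_norm_le L c :
  (forall x, norm x <= 1 -> norm (L x) <= c) -> @op_norm X L <= c.
Proof.
intros hL. apply (proj2 (op_norm_lub L c hL) c).
intros r [x [hx ->]]. exact (hL x hx).
Qed.

Lemma norm_le_op_norm L x :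
  is_linear L -> norm x <= 1 -> norm (L x) <= @op_norm X L.
Proof.
intros hL hx. destruct (linear_norm _ hL) as [M [hM hLM]].
apply (fun h => proj1 (op_norm_lub L M h) (norm (L x))); [|now exists x].
intros y hy. specialize (hLM y). assert (M * norm y <= M * 1); [|lra].
apply Rmult_le_compat_l; lra.
Qed.

Lemma op_norm_ge_0 L : is_linear L -> 0 <= @op_norm X L.
Proof.
intros hL. apply Rle_trans with (norm (L zero)); [apply norm_ge_0|].
apply norm_le_op_norm; [exact hL|rewrite norm_zero; lra].
Qed.

Lemma dist_to_compacts_glb L :
  is_linear L ->
  is_glb_Rbar (fun r => exists K : V -> V,
      is_linear K /\ precompact (unit_image K) /\
      r = @op_norm X (fun x => minus (L x) (K x)))
    (@dist_to_compacts X L).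
Proof.
intros hL. unfold dist_to_compacts.
set (E := fun r => exists K : V -> V, is_linear K /\ precompact (unit_image K) /\
  r = @op_norm X (fun x => minus (L x) (K x))).
set (F := fun r => exists K : V -> V, is_linear K /\ @compact_operator X K /\
  r = @op_norm X (fun x => minus (L x) (K x))).
change (is_glb_Rbar E (Finite (real (Glb_Rbar F)))).
assert (hEF : forall r, E r <-> F r).
{ intros r. split; intros [K [h1 [h2 h3]]]; exists K;
    (split; [exact h1|split; [now apply compact_operatorP|exact h3]]). }
rewrite -(Glb_Rbar_eqset _ _ hEF).
destruct (Glb_Rbar_correct E) as [lb glb].
assert (h0 : Rbar_le 0 (Glb_Rbar E)).
{ apply glb. intros r [K [hK [_ ->]]].
  apply op_norm_ge_0. now apply is_linear_minus_fun. }
assert (hE : E (@op_norm X (fun x => minus (L x) zero))).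
{ exists (fun _ => zero). split; [apply is_linear_zero|].
  split; [apply precompact_image_zero|reflexivity]. }
specialize (lb _ hE) as hl.
destruct (Glb_Rbar E); [now split|destruct hl|destruct h0].
Qed.

Lemma dist_to_compacts_ge_0 L : is_linear L -> 0 <= @dist_to_compacts X L.
Proof.
intros hL. apply (proj2 (dist_to_compacts_glb L hL) 0). intros r [K [hK [_ ->]]].
apply op_norm_ge_0. now apply is_linear_minus_fun.
Qed.

(** If [K] is a competitor for [M], then [K' + K] is one for [L], where [K'] is
    compact and within [e] of [L - M]. *)
Lemma dist_to_compacts_le_of_difference L M :
  is_linear L -> is_linear M ->
  (forall e, 0 < e -> exists K : V -> V, is_linear K /\ precompact (unit_image K) /\
     forall x, norm x <= 1 -> norm (minus (minus (L x) (M x)) (K x)) <= e) ->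
  @dist_to_compacts X L <= @dist_to_compacts X M.
Proof.
intros hL hM hLM. apply (proj2 (dist_to_compacts_glb M hM) (@dist_to_compacts X L)).
intros r [K [Klin [Kcpt ->]]]. apply le_epsilon. intros e he.
destruct (hLM e he) as [K' [Klin' [Kcpt' hK']]].
apply Rle_trans with (@op_norm X (fun x => minus (L x) (plus (K' x) (K x)))).
- apply (proj1 (dist_to_compacts_glb L hL)
      (@op_norm X (fun x => minus (L x) (plus (K' x) (K x))))).
  exists (fun x => plus (K' x) (K x)).
  split; [now apply is_linear_plus_fun|].
  split; [now apply precompact_image_plus|reflexivity].
- apply op_norm_le. intros x hx.
  assert (h : norm (minus (M x) (K x)) <= @op_norm X (fun x => minus (M x) (K x))).
  { apply (norm_le_op_norm (fun x => minus (M x) (K x))); [|exact hx].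
    now apply is_linear_minus_fun. }
  specialize (hK' x hx).
  replace (L x) with (plus (minus (L x) (M x)) (M x)).
  + rewrite minus_plus_plus. eapply Rle_trans; [apply norm_triangle|lra].
  + unfold minus. now rewrite -plus_assoc plus_opp_l plus_zero_r.
Qed.

End Distance.

Theorem corollary2 (X : CompleteNormedModule C_AbsRing)
    (A : operator X) (T : R -> X -> X)
    (hT : C0_semigroup T) (hA : is_generator A T)
    (hdiff : immediately_differentiable T) (hqc : quasi_compact T)
    (B : X -> X) (hB : is_linear B)
    (hBT : forall t : R, 0 < t -> compact_operator (fun x => B (T t x)))
    (S : R -> X -> X)
    (hS : C0_semigroup S) (hAB : is_generator (op_add A B) S) :
  quasi_compact S.
Proof.
apply (is_lim_le_le_loc (fun _ => 0) (fun t => dist_to_compacts (T t)));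
  [|apply is_lim_const|exact hqc].
exists 0. intros t ht.
assert (Tlin : is_linear (T t)) by (apply hT; lra).
assert (Slin : is_linear (S t)) by (apply hS; lra).
split; [now apply dist_to_compacts_ge_0|].
apply dist_to_compacts_le_of_difference; [exact Slin|exact Tlin|].
intros e he.
apply (perturbed_minus_unperturbed_near_compact A B T S hT hS hA hAB hdiff hB);
  [|exact ht|exact he].
intros s hs. now apply compact_operatorP, hBT.
Qed.
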